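(* Let $\mathbb{K}$ be an algebraically closed field of characteristic zero, $\mathcal{C}\subset\mathbb{K}^2$ an affine irreducible plane curve, $A=(a,b)\in\mathbb{K}^2$, $d\in\mathbb{K}\setminus\{0\}$, and assume that $\mathcal{C}_0\neq\emptyset$ and that $\mathcal{C}$ is not a circle centered at $A$. If $\mathcal{C}$ is not a line passing through $A$, then $\mathfrak{C}(\mathcal{C},A,d)$ has at least one simple component.
   Context: For $\mathcal{C}$ defined by an irreducible polynomial $f(y_1,y_2)$: $\mathfrak{B}(\mathcal{C},A,d)\subset\mathbb{K}^2\times\mathbb{K}^2\times\mathbb{K}$ is the set of $(\bar x,\bar y,w)$ with $f(y_1,y_2)=0$, $(x_1-y_1)^2+(x_2-y_2)^2=d^2$, $(y_2-b)(x_1-y_1)-(y_1-a)(x_2-y_2)=0$, $w((y_1-a)^2+(y_2-b)^2)=1$; $\pi_1,\pi_2$ are the projections $(\bar x,\bar y,w)\mapsto\bar x$, $\mapsto\bar y$; the conchoid $\mathfrak{C}(\mathcal{C},A,d)$ is the Zariski closure of $\pi_1(\mathfrak{B}(\mathcal{C},A,d))$. $\mathcal{C}_0=\{(p_1,p_2)\in\mathcal{C}:(p_1-a)^2+(p_2-b)^2\neq0\}$. An irreducible component $\mathcal{M}$ of $\mathfrak{C}(\mathcal{C},A,d)$ is simple if there is a non-empty Zariski dense $\Omega\subset\mathcal{M}$ with $\mathrm{Card}(\pi_2(\pi_1^{-1}(Q)))=1$ for all $Q\in\Omega$; otherwise special. A circle centered at $A$ of radius $r$ is $(y_1-a)^2+(y_2-b)^2=r^2$.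 *)

(* Defs.v *)
From HB Require Import structures.
From mathcomp Require Import all_boot all_order all_algebra.
From mathcomp Require Import mpoly.
Set Implicit Arguments. Unset Strict Implicit. Unset Printing Implicit Defensive.
Import Order.TTheory GRing.Theory.
Local Open Scope ring_scope.

Section Conchoid.
Variable K : closedFieldType.

Definition pt := (K * K)%type.
Definition pset := pt -> Prop.

Definition set_eq (S T : pset) : Prop := forall p, S p <-> T p.
Definition subset (S T : pset) : Prop := forall p, S p -> T p.

Definition ev2 (g : {mpoly K[2]}) (p : pt) : K :=
  g.@[fun i : 'I_2 => if val i == 0%N then p.1 else p.2].

Definition mconst (g : {mpoly K[2]}) : Prop := exists c : K, g = c%:MP.
Definition irreducible_mpoly (f : {mpoly K[2]}) : Prop :=
  ~ mconst f /\
  forall g h : {mpoly K[2]}, f = g * h -> mconst g \/ mconst h.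

Definition curve (f : {mpoly K[2]}) : pset := fun p => ev2 f p = 0.

Definition zero_set (F : {mpoly K[2]} -> Prop) : pset :=
  fun p => forall g, F g -> ev2 g p = 0.
Definition zclosed (Z : pset) : Prop :=
  exists F : {mpoly K[2]} -> Prop, set_eq Z (zero_set F).
Definition zclosure (S : pset) : pset :=
  fun p => forall g : {mpoly K[2]}, (forall q, S q -> ev2 g q = 0) -> ev2 g p = 0.
Definition zirreducible (Z : pset) : Prop :=
  zclosed Z /\ (exists p, Z p) /\
  forall Z1 Z2, zclosed Z1 -> zclosed Z2 ->
    set_eq Z (fun p => Z1 p \/ Z2 p) -> set_eq Z Z1 \/ set_eq Z Z2.
Definition irreducible_component (M W : pset) : Prop :=
  zirreducible M /\ subset M W /\
  forall N, zirreducible N -> subset M N -> subset N W -> set_eq N M.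

Definition Bset (f : {mpoly K[2]}) (a b d : K) (x y : pt) (w : K) : Prop :=
  ev2 f y = 0 /\
  (x.1 - y.1) ^+ 2 + (x.2 - y.2) ^+ 2 = d ^+ 2 /\
  (y.2 - b) * (x.1 - y.1) - (y.1 - a) * (x.2 - y.2) = 0 /\
  w * ((y.1 - a) ^+ 2 + (y.2 - b) ^+ 2) = 1.

Definition pi1B (f : {mpoly K[2]}) (a b d : K) : pset :=
  fun x => exists y w, Bset f a b d x y w.
Definition conchoid (f : {mpoly K[2]}) (a b d : K) : pset :=
  zclosure (pi1B f a b d).

Definition simple_component (f : {mpoly K[2]}) (a b d : K) (M : pset) : Prop :=
  exists Omega : pset,
    (exists q, Omega q) /\ subset Omega M /\ set_eq (zclosure Omega) M /\
    forall Q, Omega Q -> exists! y : pt, exists w : K, Bset f a b d Q y w.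

Definition C0 (f : {mpoly K[2]}) (a b : K) : pset :=
  fun p => curve f p /\ (p.1 - a) ^+ 2 + (p.2 - b) ^+ 2 != 0.

Definition is_circle_centered (C : pset) (a b : K) : Prop :=
  exists r : K, set_eq C (fun y => (y.1 - a) ^+ 2 + (y.2 - b) ^+ 2 = r ^+ 2).

Definition is_line_through (C : pset) (a b : K) : Prop :=
  exists u v c : K, (u != 0 \/ v != 0) /\ u * a + v * b + c = 0 /\
    set_eq C (fun y => u * y.1 + v * y.2 + c = 0).

End Conchoid.

(* Main.v *)
Require Import Defs.
From HB Require Import structures.
From Stdlib Require Import Classical.
From mathcomp Require Import all_boot all_order all_algebra.
From mathcomp Require Import mpoly ring zify.
Import GRing.Theory.
Local Open Scope ring_scope.

(** Let [S] be the set of points of the conchoid having a unique preimage. A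
    point [X] with [|X - A| = r <> 0] has only the two candidate preimages
    [A + (1 -+ d / r) (X - A)]. If [S] were finite, take a point [Y] of the
    curve such that the line [AY] misses [S] (except possibly at [A]): the point
    at signed distance [d] from [Y] on [AY] has [Y] as a preimage, hence has the
    other candidate, at distance [2d] from [Y], as a preimage too. Iterating, in
    characteristic zero, gives infinitely many points of the curve on a line
    through [A], so the curve is that line. Hence [S] is infinite; being
    contained in a proper curve, it meets some irreducible component of the
    conchoid in an infinite, thus dense, set. *)

Set Implicit Arguments.
Unset Strict Implicit.
Unset Printing Implicit Defensive.

(** * Finite predicates and minimal elements *)

Definition finitely_many (T : eqType) (P : T -> Prop) : Prop :=
  exists s : seq T, forall x, P x -> x \in s.

Lemma finitely_many_sub (T : eqType) (P Q : T -> Prop) :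
  (forall x, P x -> Q x) -> finitely_many Q -> finitely_many P.
Proof. by move=> PQ [s Qs]; exists s => x /PQ /Qs. Qed.

Lemma finitely_manyU (T : eqType) (P Q : T -> Prop) :
  finitely_many P -> finitely_many Q -> finitely_many (fun x => P x \/ Q x).
Proof.
move=> [s Ps] [t Qt]; exists (s ++ t) => x; rewrite mem_cat.
by case=> [/Ps-> //|/Qt->]; rewrite orbT.
Qed.

Lemma finitely_many_seq (I T : eqType) (s : seq I) (P : I -> T -> Prop) :
  (forall i, i \in s -> finitely_many (P i)) ->
  finitely_many (fun x => exists2 i, i \in s & P i x).
Proof.
elim: s => [|i s IHs] Pfin; first by exists [::] => x [].
apply: (@finitely_many_sub _ _ (fun x => P i x \/ exists2 j, j \in s & P j x)).
  move=> x [j]; rewrite inE => /orP[/eqP-> Px|js Px]; first by left.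
  by right; exists j.
apply: finitely_manyU; first by apply: Pfin; rewrite mem_head.
by apply: IHs => j js; apply: Pfin; rewrite inE js orbT.
Qed.

Lemma infinite_ex (T : eqType) (P : T -> Prop) :
  ~ finitely_many P -> exists x, P x.
Proof.
move=> Pinf; apply: NNPP => Pno; apply: Pinf; exists [::] => x Px.
by case: Pno; exists x.
Qed.

Lemma not_finitely_many_orbit (T : eqType) (y : nat -> T) (Q : T -> Prop) :
  injective y -> (forall n, Q (y n)) -> ~ finitely_many Q.
Proof.
move=> yinj Qy [s sP].
have : (size (map y (iota 0 (size s).+1)) <= size s)%N.
  apply: uniq_leq_size; first by rewrite map_inj_uniq ?iota_uniq.
  by move=> _ /mapP[n _ ->]; apply: sP.
by rewrite size_map size_iota ltnn.
Qed.

Lemma ex_minimal (T : Type) (m : T -> nat) (P : T -> Prop) :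
  (exists x, P x) -> exists2 x, P x & forall y, P y -> (m x <= m y)%N.
Proof.
move=> [x Px]; have [n] := ubnP (m x); elim: n x Px => // n IHn x Px lexn.
have [[y Py ltyx]|nosmaller] := classic (exists2 y, P y & (m y < m x)%N).
  by apply: (IHn y) => //; apply: leq_trans ltyx _.
exists x => // y Py; rewrite leqNgt; apply/negP => ltyx.
by apply: nosmaller; exists y.
Qed.

(** * Bivariate polynomials over an algebraically closed field *)

Section Bivariate.
Variable K : closedFieldType.
Implicit Types (p q : {poly K}) (F G g h : {poly {poly K}}) (P : pt K).

Lemma finitely_many_roots p : p != 0 -> finitely_many (fun x => root p x).
Proof.
move=> p0; have [r def_p] := closed_field_poly_normal p; exists r => x.
by rewrite def_p rootZ ?lead_coef_eq0 // root_prod_XsubC.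
Qed.

Lemma poly_eq0_roots p : ~ finitely_many (fun x => root p x) -> p = 0.
Proof.
by move=> inf_p; apply/eqP/negPn/negP => /finitely_many_roots.
Qed.

(** As in Euclid's argument, [\prod_(z <- s) ('X - z%:P) + 1] has a root, and that root is not in
    [s]. *)
Lemma infinite_field : ~ finitely_many (fun _ : K => True).
Proof.
move=> [s sP]; pose p : {poly K} := \prod_(z <- s) ('X - z%:P) + 1.
have [|x] := @closed_rootP _ p _.
  case: (s) @p sP => [|y t] p sP; first by have := sP 0 I; rewrite in_nil.
  by rewrite /p size_polyDl size_prod_XsubC // size_poly1.
rewrite /root hornerD hornerC -[_.[x]]/(\prod_(z <- s) ('X - z%:P)).[x].
have /eqP-> : root (\prod_(z <- s) ('X - z%:P)) x.
  by rewrite root_prod_XsubC sP.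
by rewrite add0r oner_eq0.
Qed.

(** The outer variable is the second coordinate: a plane polynomial is seen in K[x][y], where
    pseudo-division in y is available. *)
Definition eval_xy F P : K := F.[P.2%:P].[P.1].

Lemma eval_xyM F G P : eval_xy (F * G) P = eval_xy F P * eval_xy G P.
Proof. by rewrite /eval_xy !hornerM. Qed.

Lemma eval_xyB F G P : eval_xy (F - G) P = eval_xy F P - eval_xy G P.
Proof. by rewrite /eval_xy !(hornerD, hornerN). Qed.

Lemma eval_xyC p P : eval_xy p%:P P = p.[P.1].
Proof. by rewrite /eval_xy hornerC. Qed.

Definition fiber F (x : K) : {poly K} := map_poly (horner_eval x) F.

Lemma eval_xy_fiber F P : eval_xy F P = (fiber F P.1).[P.2].
Proof.
rewrite /eval_xy /fiber -{2}[P.2](hornerC _ P.1).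
by rewrite -[_.[P.1] in RHS]/(horner_eval P.1 _) horner_map.
Qed.

Lemma fiberM F G x : fiber (F * G) x = fiber F x * fiber G x.
Proof. exact: rmorphM. Qed.

Lemma fiber_eq0 F x :
  fiber F x = 0 -> exists G, F = ('X - x%:P)%:P * G.
Proof.
move=> Fx0; exists (map_poly (fun p => p %/ ('X - x%:P)) F); apply/polyP => i.
rewrite coefCM coef_map_id0 ?div0p // mulrC divpK // dvdp_XsubCl /root.
by have /polyP/(_ i)/eqP := Fx0; rewrite coef_map coef0.
Qed.

Definition of_xy F : {mpoly K[2]} :=
  (map_poly (horner_alg ('X_ord0 : {mpoly K[2]})) F).['X_ord_max].

Lemma of_xyD F G : of_xy (F + G) = of_xy F + of_xy G.
Proof. by rewrite /of_xy rmorphD hornerD. Qed.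

Lemma of_xyM F G : of_xy (F * G) = of_xy F * of_xy G.
Proof. by rewrite /of_xy rmorphM hornerM. Qed.

Lemma mpoly_ring_ind n (Q : {mpoly K[n]} -> Prop) :
  (forall c, Q c%:MP) -> (forall i, Q 'X_i) ->
  (forall e f, Q e -> Q f -> Q (e + f)) ->
  (forall e f, Q e -> Q f -> Q (e * f)) -> forall f, Q f.
Proof.
move=> QC QX QD QM; elim/mpolyind=> [|c m f _ _ Qf]; first by rewrite -mpolyC0.
apply: QD Qf; rewrite -mul_mpolyC; apply: (QM) => //.
rewrite mpolyXE_id; elim/big_ind: _ => [|u v|i _]; [by rewrite -mpolyC1|exact: QM|].
by elim: (m i) => [|k IHk]; rewrite ?expr0 -?mpolyC1 // exprS; apply: (QM).
Qed.

Lemma of_xy_surj (f : {mpoly K[2]}) : exists F, f = of_xy F.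
Proof.
elim/mpoly_ring_ind: f => [c|i|_ _ [F ->] [G ->]|_ _ [F ->] [G ->]].
- exists c%:P%:P; rewrite /of_xy map_polyC hornerC /= horner_algC.
  by rewrite -mul_mpolyC mulr1.
- case: i => [[|[|//]] lt_i].
    exists 'X%:P; rewrite /of_xy map_polyC hornerC /= horner_algX.
    by congr mpolyX; congr mnm1; apply: val_inj.
  exists 'X; rewrite /of_xy map_polyX hornerX.
  by congr mpolyX; congr mnm1; apply: val_inj.
- by exists (F + G); rewrite of_xyD.
- by exists (F * G); rewrite of_xyM.
Qed.

Lemma ev2D (e f : {mpoly K[2]}) P : ev2 (e + f) P = ev2 e P + ev2 f P.
Proof. exact: mevalD. Qed.

Lemma ev2M (e f : {mpoly K[2]}) P : ev2 (e * f) P = ev2 e P * ev2 f P.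
Proof. exact: mevalM. Qed.

Lemma ev2C (c : K) P : ev2 c%:MP P = c.
Proof. exact: mevalC. Qed.

Lemma ev2_of_xy F P : ev2 (of_xy F) P = eval_xy F P.
Proof.
elim/poly_ind: F => [|F p IHF].
  by rewrite /eval_xy /of_xy rmorph0 !horner0 /ev2 meval0.
rewrite of_xyD of_xyM ev2D ev2M IHF /eval_xy !hornerE; congr (_ * _ + _).
  by rewrite /of_xy map_polyX hornerX /ev2 mevalXU.
rewrite /of_xy map_polyC hornerC /=.
elim/poly_ind: p => [|p c IHp]; first by rewrite rmorph0 horner0 /ev2 meval0.
rewrite rmorphD rmorphM /= horner_algX horner_algC ev2D ev2M IHp !hornerE.
by rewrite -mul_mpolyC mulr1 ev2C /ev2 mevalXU.
Qed.

Lemma fiber_eq0_infinite F x :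
  ~ finitely_many (fun P => P.1 = x /\ eval_xy F P = 0) -> fiber F x = 0.
Proof.
move=> Finf; apply: poly_eq0_roots => -[r rP]; apply: Finf.
exists [seq (x, y) | y <- r] => -[_ y] /= [-> Fxy0].
by rewrite map_f //; apply: rP; apply/eqP; rewrite eval_xy_fiber in Fxy0.
Qed.

(** A form of Gauss's lemma: the hypothesis says that [g] has no factor in x alone. At a root [x] of
    [c] the fiber of [F * g] vanishes, hence that of [F], and ['X - x%:P] cancels; induct on the
    degree of [c]. *)
Lemma dvd_cancel g : (forall x, fiber g x != 0) ->
  forall c h F, c != 0 -> c%:P * h = F * g -> exists k, h = k * g.
Proof.
move=> g_fib c; have [n] := ubnP (size c); elim: n c => // n IHn c ltcn h F c0 E.
have [/eqP/size_poly1P[e e0 def_c]|/closed_rootP[x]] := altP (size c =P 1%N).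
  exists (e^-1%:P%:P * F); rewrite -mulrA -E def_c mulrA -!rmorphM mulVf //.
  by rewrite !rmorph1 mul1r.
case/factor_theorem => c' def_c.
have c'0 : c' != 0 by apply: contra_neq c0 => c'0; rewrite def_c c'0 mul0r.
have /eqP : fiber F x * fiber g x = 0.
  rewrite -fiberM -E fiberM def_c rmorphM /= fiberM {2}/fiber map_polyC /=.
  by rewrite /horner_eval hornerXsubC subrr mulr0 mul0r.
rewrite mulf_eq0 (negPf (g_fib x)) orbF => /eqP/fiber_eq0[F' def_F].
apply: (IHn c' _ h F') => //.
  by move: ltcn; rewrite def_c size_Mmonic ?monicXsubC // size_XsubC addn2.
apply: (@mulfI _ ('X - x%:P)%:P); first by rewrite polyC_eq0 polyXsubC_eq0.
by rewrite !mulrA -def_F -E def_c rmorphM /= (mulrC c'%:P).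
Qed.

(** * Irreducible components of plane loci *)

Definition infinite_locus (S : pt K -> Prop) F :=
  ~ finitely_many (fun P => S P /\ eval_xy F P = 0).

Lemma infinite_locusM (S : pt K -> Prop) F G :
  infinite_locus S (F * G) -> infinite_locus S F \/ infinite_locus S G.
Proof.
move=> FGinf; apply: NNPP => /not_or_and[/NNPP Ffin /NNPP Gfin]; apply: FGinf.
apply: finitely_many_sub (finitely_manyU Ffin Gfin) => P [SP /eqP].
by rewrite eval_xyM mulf_eq0 => /orP[] /eqP E; [left|right].
Qed.

(* A substitute for decomposing a plane curve into irreducible components: [g]
   generates the ideal of an irreducible component that meets [S] in an
   infinite set. *)
Lemma ex_dominating_poly (S : pt K -> Prop) G :
  G != 0 -> infinite_locus S G ->
  exists2 g, infinite_locus S g &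
    forall h, infinite_locus (fun P => S P /\ eval_xy g P = 0) h ->
      exists k, h = k * g.
Proof.
move=> G0 SG.
(* If [S] has infinitely many points on a vertical line, that line is the component. *)
have [[x Sx]|nvert] := classic (exists x, infinite_locus S ('X - x%:P)%:P).
  exists ('X - x%:P)%:P => // h hinf.
  have [|k ->] := @fiber_eq0 h x; last by exists k; rewrite mulrC.
  apply: fiber_eq0_infinite => hfin; apply: hinf.
  apply: finitely_many_sub hfin => P [[_ E] ->]; split=> //.
  by apply/eqP; rewrite -subr_eq0 -hornerXsubC -eval_xyC E.
(* [g] will minimize first the degree in y, then the degree in x of the leading coefficient. *)
pose cand g := g != 0 /\ infinite_locus S g.
have [g1 [g10 Sg1] g1min] :=
  ex_minimal (fun g => size g) (ex_intro cand G (conj G0 SG)).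
have [|g [[g0 Sg] gmin] lmin] := @ex_minimal _ (fun g => size (lead_coef g))
  (fun g => cand g /\ forall h, cand h -> (size g <= size h)%N).
  by exists g1.
(* Cancelling a vertical factor would lower the degree of the leading coefficient, against the
   second minimality. *)
have g_fib x : fiber g x != 0.
  apply/negP => /eqP/fiber_eq0[g' def_g].
  have g'0 : g' != 0 by apply: contra_neq g0 => g'0; rewrite def_g g'0 mulr0.
  have X0 : 'X - x%:P != 0 by rewrite polyXsubC_eq0.
  have Sg' : infinite_locus S g'.
    by move: Sg; rewrite def_g => /infinite_locusM[Sx|//]; case: nvert; exists x.
  have eq_size : size g' = size g by rewrite def_g mul_polyC size_scale.
  have /lmin : cand g' /\ forall h, cand h -> (size g' <= size h)%N.
    by split=> // h /gmin; rewrite eq_size.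
  rewrite def_g lead_coefM lead_coefC size_mul ?lead_coef_eq0 //.
  by rewrite size_XsubC ltnn.
exists g => // h hinf.
(* The pseudo-remainder vanishes at the common zeros of [g] and [h]; if nonzero, it is a candidate
   of smaller degree in y. *)
have := Pdiv.Idomain.divp_eq h g; rewrite -mul_polyC => divE.
have [r0|r0] := eqVneq (h %% g) 0.
  move: divE; rewrite r0 addr0; apply: dvd_cancel => //.
  by rewrite expf_neq0 // lead_coef_eq0.
have /gmin : cand (h %% g).
  split=> // rfin; apply: hinf; apply: finitely_many_sub rfin => P.
  move=> [[SP gP] hP]; split=> //.
  have -> : h %% g = (lead_coef g ^+ scalp h g)%:P * h - h %/ g * g.
    by rewrite divE addrC addKr.
  by rewrite eval_xyB !eval_xyM gP hP !mulr0 subrr.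
by rewrite leqNgt ltn_modp g0.
Qed.

Lemma zclosed_and (N : pset K) F :
  zclosed N -> zclosed (fun P => N P /\ eval_xy F P = 0).
Proof.
move=> [I NI]; exists (fun e => I e \/ e = of_xy F) => P; split.
  by move=> [/NI NP FP] e [/NP //|->]; rewrite ev2_of_xy.
move=> IP; split; last by rewrite -ev2_of_xy; apply: IP; right.
by apply/NI => e Ie; apply: IP; left.
Qed.

(** Gives the maximality of a component. A smallest nonzero [h] vanishing on [N] is [k * g]; by
    irreducibility [g] or [k] vanishes on [N], and [k] is too small unless [g] is a nonzero
    constant, which has no zero. *)
Lemma sub_dominated_locus (N : pset K) G g :
  zirreducible N -> (exists P, eval_xy g P = 0) ->
  (forall h, (forall P, N P -> eval_xy h P = 0) ->
    exists k : {poly {poly K}}, h = k * g) ->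
  G != 0 -> (forall P, N P -> eval_xy G P = 0) ->
  forall P, N P -> eval_xy g P = 0.
Proof.
move=> [Ncl [_ Nirr]] [P0 gP0] gdvd G0 NG.
(* This measure drops strictly when a nonconstant factor is removed. *)
have [|h [h0 Nh] hmin] := @ex_minimal _ (fun h => size h + size (lead_coef h))%N
  (fun h => h != 0 /\ forall P, N P -> eval_xy h P = 0).
  by exists G.
have [k def_h] := gdvd h Nh.
have : set_eq N (fun P => (N P /\ eval_xy g P = 0) \/ (N P /\ eval_xy k P = 0)).
  move=> P; split=> [NP|[] []//]; have /eqP := Nh P NP.
  by rewrite def_h eval_xyM mulf_eq0 => /orP[] /eqP ?; [right|left].
case/(Nirr _ _ (zclosed_and g Ncl) (zclosed_and k Ncl)) => eqN P /eqN[] // NP kP.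
move: h0; rewrite def_h mulf_eq0 => /norP[k0 g0].
have := hmin k; rewrite def_h lead_coefM !size_mul ?lead_coef_eq0 // => lekg.
have /lekg {}lekg : k != 0 /\ forall P, N P -> eval_xy k P = 0.
  by split=> // Q /eqN[].
have arith (m n m' n' : nat) : (0 < n -> 0 < n' ->
    (m + n).-1 + (m' + n').-1 <= m + m' -> n = 1 /\ n' = 1)%N by lia.
have [||/eqP/size_poly1P[c c0 def_g] lg1] := arith _ _ _ _ _ _ lekg.
- by rewrite size_poly_gt0.
- by rewrite size_poly_gt0 lead_coef_eq0.
have /size_poly1P[e e0 def_c] : size c == 1%N by rewrite -lg1 def_g lead_coefC.
by move: gP0 e0; rewrite def_g eval_xyC def_c hornerC => ->; rewrite eqxx.
Qed.

Lemma ex_component_dense (S W : pset K) G :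
  Defs.subset S W -> ~ finitely_many S -> G != 0 ->
  (forall P, W P -> eval_xy G P = 0) ->
  exists M : pset K, irreducible_component M (zclosure W) /\
    exists Omega : pset K, [/\ exists P, Omega P, Defs.subset Omega S,
      Defs.subset Omega M & set_eq (zclosure Omega) M].
Proof.
move=> SW Sinf G0 WG.
have [|g Sg gdvd] := @ex_dominating_poly S G G0.
  by move=> Gfin; apply: Sinf; apply: finitely_many_sub Gfin => P /[dup] /SW/WG.
pose M P := eval_xy g P = 0; pose Omega P := S P /\ M P.
(* Any infinite part of [Omega] is dense in [M]: a polynomial vanishing on it is a multiple of
   [g]. *)
have dvdM e : ~ finitely_many (fun P => Omega P /\ ev2 e P = 0) ->
    forall P, M P -> ev2 e P = 0.
  have [F ->] := of_xy_surj e => inf P MP; rewrite ev2_of_xy.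
  have [|k ->] := gdvd F; last by rewrite eval_xyM MP mulr0.
  move=> Ffin; apply: inf; apply: finitely_many_sub Ffin => Q [OQ].
  by rewrite ev2_of_xy.
have OmegaM e : (forall P, Omega P -> ev2 e P = 0) -> forall P, M P -> ev2 e P = 0.
  move=> Oe; apply: dvdM => fin; apply: Sg; apply: finitely_many_sub fin => P OP.
  by split=> //; apply: Oe.
have [P0 OP0] := infinite_ex Sg.
have Mcl : zclosed M.
  exists (eq (of_xy g)) => P; split=> [MP _ <-|]; first by rewrite ev2_of_xy.
  by move=> /(_ _ erefl); rewrite ev2_of_xy.
exists M; split; last first.
  exists Omega; split=> [|P []|P []|P] //; first by exists P0.
  split=> [|MP e /OmegaM]; last exact.
  by move=> /(_ (of_xy g)); rewrite ev2_of_xy; apply=> Q [_]; rewrite ev2_of_xy.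
split; last split.
- split=> //; split; first by exists P0; case: OP0.
  have closed_case Z : zclosed Z -> (forall P, Z P -> M P) ->
      ~ finitely_many (fun P => Omega P /\ Z P) -> set_eq M Z.
    move=> [I ZI] ZM inf P; split=> [MP|/ZM//]; apply/ZI => e Ie.
    apply: dvdM MP => fin; apply: inf; apply: finitely_many_sub fin => Q [OQ].
    by move=> /ZI/(_ e Ie).
  (* If neither piece were all of [M], each would meet [Omega] in a finite set, and [Omega] would be
     finite. *)
  move=> Z1 Z2 Z1cl Z2cl eqM; apply: NNPP => /not_or_and[nZ1 nZ2].
  apply: Sg; apply: (@finitely_many_sub _ _
    (fun P => (Omega P /\ Z1 P) \/ (Omega P /\ Z2 P))).
    by move=> P /[dup] OP [_ /eqM[]]; [left|right].
  by apply: finitely_manyU; apply: NNPP => inf; [apply: nZ1|apply: nZ2];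
    apply: closed_case inf => // P ZP; apply/eqM; [left|right].
- by move=> P MP e We; apply: OmegaM MP => Q [/SW WQ _]; apply: We.
- move=> N Nirr MN NW P; split; last exact: MN.
  apply: (@sub_dominated_locus N G) => //; first by exists P0; case: OP0.
    move=> h Nh; apply: gdvd => fin; apply: Sg.
    by apply: finitely_many_sub fin => Q [SQ MQ]; split=> //; apply/Nh/MN.
  move=> Q /NW/(_ (of_xy G)); rewrite ev2_of_xy; apply=> R WR.
  by rewrite ev2_of_xy WG.
Qed.

(** * Lines contained in a curve, and infinity of plane curves *)

Lemma line_of_infinite (f : {mpoly K[2]}) (u v c : K) :
  irreducible_mpoly f -> u != 0 \/ v != 0 ->
  ~ finitely_many (fun P => curve f P /\ u * P.1 + v * P.2 + c = 0) ->
  set_eq (curve f) (fun P => u * P.1 + v * P.2 + c = 0).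
Proof.
move=> [fnconst firr] uv0 inf; have [F def_f] := of_xy_surj f.
(* The equation [L] of the line divides [F], because [F] restricted to the line has infinitely many
   zeros; irreducibility then makes the cofactor constant. *)
have [L [G [def_F Lline]]] : exists L G, F = G * L /\
    forall P, eval_xy L P = 0 <-> u * P.1 + v * P.2 + c = 0.
  have [v0|v0] := eqVneq v 0.
    have u0 : u != 0 by case: uv0 => //; rewrite v0 eqxx.
    have [|G ->] := @fiber_eq0 F (- (c / u)).
      apply: fiber_eq0_infinite => fin; apply: inf.
      apply: finitely_many_sub fin => P []; rewrite def_f /curve ev2_of_xy v0 => ->.
      by move=> E; split=> //; apply: (mulfI u0); rewrite -[LHS]subr0 -E; field.
    exists ('X - (- (c / u))%:P)%:P, G; split=> [|P]; first exact: mulrC.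
    rewrite eval_xyC hornerXsubC v0 mul0r addr0.
    have -> : u * P.1 + c = u * (P.1 - - (c / u)) by field.
    by split=> [->|/eqP]; rewrite ?mulr0 // mulf_eq0 (negPf u0) => /eqP.
  pose m : {poly K} := (- (u / v)) *: 'X - (c / v)%:P.
  have onm P : u * P.1 + v * P.2 + c = 0 <-> P.2 = m.[P.1].
    rewrite /m !hornerE; split=> [E|->]; last by field.
    by apply: (mulfI v0); rewrite -[LHS]subr0 -E; field.
  have /factor_theorem[G ->] : root F m.
    apply/eqP/poly_eq0_roots => -[r rP]; apply: inf.
    exists [seq (x, m.[x]) | x <- r] => -[x y] /= [].
    rewrite def_f /curve ev2_of_xy => Fxy /(onm (x, y)) /= def_y.
    rewrite def_y map_f //; apply: rP; apply/eqP; rewrite -[RHS]Fxy.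
    rewrite eval_xy_fiber /= def_y -[_.[x] in LHS]/(horner_eval x _).
    by rewrite -horner_map.
  exists ('X - m%:P), G; split=> // P; rewrite onm eval_xyB eval_xyC /eval_xy.
  by rewrite hornerX hornerC; split=> [/subr0_eq|->]; rewrite ?subrr.
have [P0 [_ P0line]] := infinite_ex inf.
case: (firr (of_xy G) (of_xy L)); first by rewrite -of_xyM -def_F.
  move=> [k def_k] P; rewrite /curve def_f def_F of_xyM ev2M def_k ev2C ev2_of_xy.
  have k0 : k != 0.
    apply/eqP => k0; apply: fnconst; exists 0.
    by rewrite def_f def_F of_xyM def_k k0 mpolyC0 mul0r.
  rewrite -Lline; split=> [/eqP|->]; last exact: mulr0.
  by rewrite mulf_eq0 (negPf k0) => /eqP.
(* A constant [L] with a zero is zero, so the line would be the whole plane. *)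
move=> [k def_k].
have k0 : k = 0 by rewrite -(ev2C k P0) -def_k ev2_of_xy; apply/Lline.
have all_line P : u * P.1 + v * P.2 + c = 0.
  by apply/Lline; rewrite -ev2_of_xy def_k ev2C.
have c0 : c = 0 by have := all_line (0, 0); rewrite /= !mulr0 !add0r.
have u0 : u = 0 by have := all_line (1, 0); rewrite /= c0 mulr0 mulr1 !addr0.
have v0 : v = 0 by have := all_line (0, 1); rewrite /= c0 mulr0 mulr1 add0r addr0.
by case: uv0; rewrite ?u0 ?v0 eqxx.
Qed.

Lemma curve_infinite (f : {mpoly K[2]}) : ~ mconst f -> ~ finitely_many (curve f).
Proof.
have [F ->] := of_xy_surj f => nconst [s sP].
(* Outside finitely many abscissas the fibers have no root, so they are constant; [F] is then a
   polynomial in x alone, and a root of it yields a whole vertical line. *)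
have no_root x : x \notin map fst s -> size (fiber F x) = 1%N.
  move=> xs; apply/eqP/negPn/negP => /closed_rootP[y /eqP Fxy].
  move/negP: xs; apply; apply: (map_f fst (x := (x, y))); apply: sP.
  by rewrite /curve ev2_of_xy eval_xy_fiber.
have def_F : F = (F`_0)%:P.
  apply/polyP => -[|i]; rewrite coefC //=; apply: poly_eq0_roots => -[r rP].
  apply: infinite_field; exists (map fst s ++ r) => x _; rewrite mem_cat.
  case: (boolP (x \in map fst s)) => //= /no_root sz; apply: rP.
  rewrite /root -[_.[x]]/(horner_eval x _) -coef_map.
  by rewrite -/(fiber F x) nth_default // sz.
apply: nconst; have [sz|] := altP (size F`_0 =P 1%N).
  have /eqP/size_poly1P[c _ def_c] := sz; exists c.
  rewrite def_F def_c /of_xy map_polyC hornerC /= horner_algC.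
  by rewrite -mul_mpolyC mulr1.
move=> /closed_rootP[x /eqP Fx]; exfalso; apply: infinite_field.
exists (map snd s) => y _.
apply: (map_f snd (x := (x, y))); apply: sP.
by rewrite /curve ev2_of_xy def_F eval_xyC.
Qed.

(** * Squared distances, homotheties and preimages of conchoid points *)

Definition sqdist (A P : pt K) : K := (P.1 - A.1) ^+ 2 + (P.2 - A.2) ^+ 2.

Definition homothety (A : pt K) (t : K) P : pt K :=
  (A.1 + t * (P.1 - A.1), A.2 + t * (P.2 - A.2)).

Lemma sqdist_homothety (A : pt K) t P :
  sqdist A (homothety A t P) = t ^+ 2 * sqdist A P.
Proof. by rewrite /sqdist /=; ring. Qed.

Lemma ex_sqrt (x : K) : exists r, r ^+ 2 = x.
Proof.
have [|r] := @closed_rootP _ ('X^2 - x%:P) _; first by rewrite size_XnsubC.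
by rewrite /root !hornerE subr_eq0 => /eqP; exists r.
Qed.

(** The image of [P] is the point of the line AP at signed distance [d] from [P]; the choice of the
    square root [r] fixes the direction. *)
Lemma Bset_homothety (f : {mpoly K[2]}) (A : pt K) d P r :
  curve f P -> r ^+ 2 = sqdist A P -> r != 0 ->
  exists w, Bset f A.1 A.2 d (homothety A (1 + d / r) P) P w.
Proof.
rewrite /sqdist => fP rP r0; exists (r ^- 2); split=> //; split; last split.
- rewrite /=.
  have -> (x y z t : K) : (x + (1 + d / r) * (y - x) - y) ^+ 2 +
    (z + (1 + d / r) * (t - z) - t) ^+ 2
    = (d / r) ^+ 2 * ((y - x) ^+ 2 + (t - z) ^+ 2) by field.
  by rewrite -rP; field.
- by rewrite /=; field.
- by rewrite -rP mulVf // expf_neq0.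
Qed.

(* A preimage of [X] lies on the line [AX] at distance [d] from [X], hence there
   are only two candidates. *)
Lemma Bset_fiber (f : {mpoly K[2]}) (A : pt K) d X P w r :
  Bset f A.1 A.2 d X P w -> r ^+ 2 = sqdist A X -> r != 0 ->
  P = homothety A (1 - d / r) X \/ P = homothety A (1 + d / r) X.
Proof.
case: A X P => a b [x1 x2] [y1 y2] [_ [/= dE [colE wE]]].
rewrite /sqdist /homothety /= => rE r0.
(* The ratio of X - A to P - A, computed by a scalar product since [w] inverts the squared distance
   from [A] to [P]. *)
pose t := w * ((x1 - a) * (y1 - a) + (x2 - b) * (y2 - b)).
have n0 : (y1 - a) ^+ 2 + (y2 - b) ^+ 2 != 0.
  by apply: contra_eq_neq wE => ->; rewrite mulr0 eq_sym oner_eq0.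
have wV : w = ((y1 - a) ^+ 2 + (y2 - b) ^+ 2)^-1.
  by apply: (mulIf n0); rewrite wE mulVf.
have x1E : x1 - a = t * (y1 - a).
  rewrite /t wV; apply/eqP; rewrite -subr_eq0; apply/eqP.
  have -> : x1 - a - ((y1 - a) ^+ 2 + (y2 - b) ^+ 2)^-1 *
      ((x1 - a) * (y1 - a) + (x2 - b) * (y2 - b)) * (y1 - a) =
    (y2 - b) / ((y1 - a) ^+ 2 + (y2 - b) ^+ 2)
      * ((y2 - b) * (x1 - y1) - (y1 - a) * (x2 - y2)) by field.
  by rewrite colE mulr0.
have x2E : x2 - b = t * (y2 - b).
  rewrite /t wV; apply/eqP; rewrite -subr_eq0; apply/eqP.
  have -> : x2 - b - ((y1 - a) ^+ 2 + (y2 - b) ^+ 2)^-1 *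
      ((x1 - a) * (y1 - a) + (x2 - b) * (y2 - b)) * (y2 - b) =
    - (y1 - a) / ((y1 - a) ^+ 2 + (y2 - b) ^+ 2)
      * ((y2 - b) * (x1 - y1) - (y1 - a) * (x2 - y2)) by field.
  by rewrite colE mulr0.
have t0 : t != 0.
  apply: contra_neq r0 => t0; apply/eqP.
  by rewrite -[_ == 0](@expf_eq0 _ r 2) rE x1E x2E t0 !mul0r expr0n addr0.
have y1E : y1 - a = t^-1 * (x1 - a) by rewrite x1E mulKf.
have y2E : y2 - b = t^-1 * (x2 - b) by rewrite x2E mulKf.
(* X - P is [1 - t^-1] times X - A; the two signs of the square root give the two candidates. *)
have /eqP : (1 - t^-1) ^+ 2 * r ^+ 2 = d ^+ 2.
  rewrite rE -dE -[x1 - y1](subrKA a) -[x2 - y2](subrKA b).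
  rewrite -(opprB y1) -(opprB y2) y1E y2E; ring.
rewrite -exprMn eqf_sqr => /orP[] /eqP tr.
  left; have -> : 1 - d / r = t^-1 by rewrite -tr mulfK // subKr.
  by rewrite -y1E -y2E !(addrC _ (_ - _)) !subrK.
right; have -> : 1 + d / r = t^-1.
  by rewrite -[d]opprK -tr mulNr mulfK // subKr.
by rewrite -y1E -y2E !(addrC _ (_ - _)) !subrK.
Qed.

Lemma natr_pchar0_inj : [pchar K] =i pred0 -> injective (fun n => n%:R : K).
Proof.
move=> /pcharf0P char0 m n /=.
wlog le_mn : m n / (m <= n)%N.
  by move=> W E; case/orP: (leq_total m n) => le; [apply: W|apply/esym/W].
move=> E; apply/eqP; rewrite eqn_leq le_mn /= -subn_eq0 -char0 natrB //.
by rewrite E subrr.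
Qed.

(** * Curves with finitely many points on each line through [A], and unique preimages *)

Definition finite_on_lines_through (C : pset K) (A : pt K) :=
  forall u v, u != 0 \/ v != 0 ->
    finitely_many (fun P => C P /\ u * (P.1 - A.1) + v * (P.2 - A.2) = 0).

Lemma finite_isotropic (C : pset K) (A : pt K) :
  finite_on_lines_through C A -> finitely_many (fun P => C P /\ sqdist A P = 0).
Proof.
(* With [i] a square root of -1, the squared distance factors into two isotropic lines through
   [A]. *)
move=> Cfin; have [i i2] := ex_sqrt (- 1).
have l1 := Cfin 1 i (or_introl (oner_neq0 _)).
have l2 := Cfin 1 (- i) (or_introl (oner_neq0 _)).
apply: finitely_many_sub (finitely_manyU l1 l2) => P [CP].
have -> : sqdist A P = (1 * (P.1 - A.1) + i * (P.2 - A.2)) *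
                       (1 * (P.1 - A.1) + - i * (P.2 - A.2)).
  rewrite /sqdist; ring: i2.
by move=> /eqP; rewrite mulf_eq0 => /orP[] /eqP E; [left|right].
Qed.

Lemma finite_on_lines (f : {mpoly K[2]}) (A : pt K) :
  irreducible_mpoly f -> ~ is_line_through (curve f) A.1 A.2 ->
  finite_on_lines_through (curve f) A.
Proof.
move=> firr noline u v uv0; apply: NNPP => inf; apply: noline.
have lineE P : u * (P.1 - A.1) + v * (P.2 - A.2) =
    u * P.1 + v * P.2 - (u * A.1 + v * A.2) by ring.
exists u, v, (- (u * A.1 + v * A.2)); split=> //; split; first by rewrite addrN.
apply: line_of_infinite => // fin; apply: inf.
by apply: finitely_many_sub fin => P [fP]; rewrite lineE.
Qed.

Lemma unique_preimage_infinite (f : {mpoly K[2]}) (A : pt K) (d : K) :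
  [pchar K] =i pred0 -> d != 0 -> ~ finitely_many (curve f) ->
  finite_on_lines_through (curve f) A ->
  ~ finitely_many (fun X => exists! y : pt K, exists w, Bset f A.1 A.2 d X y w).
Proof.
move=> char0 d0 Cinf Cfin [s sP].
have /pcharf0P natr_eq0 := char0.
(* The points of the curve lying on a line from [A] to another point of [s]. *)
pose bad P := exists2 Q, Q \in s & curve f P /\ (Q <> A /\
  - (Q.2 - A.2) * (P.1 - A.1) + (Q.1 - A.1) * (P.2 - A.2) = 0).
have bad_fin : finitely_many bad.
  apply: finitely_many_seq => Q _.
  have [->|/eqP QA] := eqVneq Q A; first by exists [::] => P [_ []].
  apply: finitely_many_sub (Cfin (- (Q.2 - A.2)) (Q.1 - A.1) _).
    by move=> P [? []].
  apply: NNPP => /not_or_and[/negP/negPn]; rewrite oppr_eq0 subr_eq0 => /eqP E2.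
  move=> /negP/negPn; rewrite subr_eq0 => /eqP E1; apply: QA.
  by rewrite [Q]surjective_pairing [A]surjective_pairing E1 E2.
have [Y [CY Ygood Yn0]] : exists Y, [/\ curve f Y, ~ bad Y & sqdist A Y <> 0].
  apply: NNPP => nY; apply: Cinf.
  apply: finitely_many_sub (finitely_manyU bad_fin (finite_isotropic Cfin)).
  move=> P CP; apply: NNPP => /not_or_and[nbad niso]; apply: nY; exists P.
  by split=> // E; apply: niso.
(* The sign of [r] is chosen so that the iteration never reaches [A]: if r + kd = 0, then k > 0 and
   -r + ld = (k + l)d is nonzero in characteristic zero. *)
have [r rY r_neq0] : exists2 r, r ^+ 2 = sqdist A Y & forall k, r + k%:R * d != 0.
  have [r rY] := ex_sqrt (sqdist A Y).
  have [[k /eqP rk]|nk] := classic (exists k, r + k%:R * d == 0); last first.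
    by exists r => // k; apply/negP => rk; apply: nk; exists k.
  exists (- r) => [|l]; first by rewrite sqrrN.
  have -> : - r + l%:R * d = (k + l)%:R * d.
    by move: rk => /eqP; rewrite addr_eq0 => /eqP->; rewrite natrD; ring.
  rewrite mulf_neq0 // natr_eq0 addn_eq0 negb_and.
  have [k0|//] := eqVneq k 0%N; case: Yn0; rewrite -rY.
  by move: rk; rewrite k0 mul0r addr0 => ->; rewrite expr0n.
have r0 : r != 0 by have := r_neq0 0%N; rewrite mul0r addr0.
(* On the line AY, at signed distance from [A] equal to [r] plus a multiple of [d]: even multiples
   for the curve points [y n], odd ones for the conchoid points [x n]. *)
pose y n := homothety A ((r + (n * 2)%:R * d) / r) Y.
pose x n := homothety A ((r + (n * 2).+1%:R * d) / r) Y.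
have Cy n : curve f (y n).
  elim: n => [|n IHn].
    suff -> : y 0%N = Y by [].
    rewrite /y /homothety mul0n mul0r addr0 mulfV // !mul1r.
    by rewrite !(addrC _ (_ - _)) !subrK -surjective_pairing.
  have dist t : sqdist A (homothety A ((r + t%:R * d) / r) Y) = (r + t%:R * d) ^+ 2.
    by rewrite sqdist_homothety -rY; field.
  have [w] := Bset_homothety d IHn (esym (dist _)) (r_neq0 _).
  have -> : homothety A (1 + d / (r + (n * 2)%:R * d)) (y n) = x n.
    have := r_neq0 (n * 2)%N; rewrite natrM.
    rewrite /x /y /homothety /= -[(n * 2).+1%:R]natr1 natrM => rn0.
    by congr pair; field; rewrite r0.
  move=> Bxy; have distx := dist (n * 2).+1.
  have xA : x n <> A.
    move=> xA; move: distx; rewrite -/(x n) xA /sqdist !subrr expr0n addr0.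
    by move=> /esym/eqP; rewrite expf_eq0 (negPf (r_neq0 _)).
  (* A unique preimage would put [x n] in [s], and [Y] is on the line from [A] to [x n]. *)
  have nuniq : ~ exists! P : pt K, exists w, Bset f A.1 A.2 d (x n) P w.
    move=> /sP xs; apply: Ygood; exists (x n) => //; split=> //; split=> //.
    by rewrite /x /=; ring.
  have [P Pw Py] : exists2 P, exists w, Bset f A.1 A.2 d (x n) P w & y n <> P.
    apply: NNPP => nP; apply: nuniq; exists (y n); split; first by exists w.
    by move=> P Pw; apply: NNPP => Py; apply: nP; exists P.
  have [w' BxP] := Pw; have CP : curve f P by case: BxP.
  have := r_neq0 (n * 2).+1; rewrite -[(n * 2).+1%:R]natr1 natrM => rn0.
  (* The first candidate is [y n] itself, so the second preimage is [y n.+1]. *)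
  have [] := Bset_fiber BxP (esym distx) (r_neq0 _) => def_P.
    case: Py; rewrite def_P /x /y /homothety /= -[(n * 2).+1%:R]natr1.
    by congr pair; field; rewrite r0.
  suff -> : y n.+1 = P by [].
  rewrite def_P /x /y /homothety /= -[(n * 2).+1%:R]natr1 mulSn natrD.
  by congr pair; field; rewrite r0.
have Yline : - (Y.2 - A.2) != 0 \/ Y.1 - A.1 != 0.
  apply: NNPP => /not_or_and[/negP/negPn]; rewrite oppr_eq0 => /eqP E2.
  by move=> /negP/negPn/eqP E1; apply: Yn0; rewrite /sqdist E1 E2 expr0n addr0.
apply: (@not_finitely_many_orbit _ y) (Cfin _ _ Yline) => [m n eq_y|n]; last first.
  by split=> //; rewrite /y /=; ring.
have two0 : 2%:R != 0 :> K by rewrite natr_eq0.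
apply: (natr_pchar0_inj char0); apply/eqP; rewrite -subr_eq0; apply: contraT => mn0.
(* For distinct indices the ratios differ, so equal images would force Y = A. *)
have coef0 z c : c + (r + (m * 2)%:R * d) / r * z = c + (r + (n * 2)%:R * d) / r * z ->
    z = 0.
  move=> /addrI/eqP; rewrite -subr_eq0 -mulrBl.
  have -> : (r + (m * 2)%:R * d) / r - (r + (n * 2)%:R * d) / r =
    (m%:R - n%:R) * (2%:R * d / r) by rewrite !natrM; field.
  rewrite mulf_eq0 mulf_eq0 (negPf mn0) /= !mulf_eq0 invr_eq0.
  by rewrite (negPf two0) (negPf d0) (negPf r0) => /eqP.
case: Yn0; move: eq_y; rewrite /y /homothety => -[/coef0 E1 /coef0 E2].
by rewrite /sqdist E1 E2 expr0n addr0.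
Qed.

(** * A polynomial equation for the conchoid *)

Lemma ex_sqdist_mpoly (A : pt K) :
  exists N : {mpoly K[2]}, forall X, ev2 N X = sqdist A X.
Proof.
exists (('X_ord0 - A.1%:MP) ^+ 2 + ('X_ord_max - A.2%:MP) ^+ 2) => X.
by rewrite /ev2 mevalD !expr2 !mevalM !mevalB !mevalC !mevalXU.
Qed.

(** Powers of [r] clear the denominators, and [r ^+ 2 = sqdist A X] reduces the numerator to degree
    at most one in [r]. *)
Lemma homothety_numerator (f : {mpoly K[2]}) (A : pt K) (d : K) :
  exists n (p q : {mpoly K[2]}), forall X r,
    r ^+ 2 = sqdist A X -> r != 0 ->
    r ^+ n * ev2 f (homothety A (1 - d / r) X) = ev2 p X + r * ev2 q X.
Proof.
have [N ev2N] := ex_sqdist_mpoly A.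
pose num n (e p q : {mpoly K[2]}) := forall X r, r ^+ 2 = sqdist A X -> r != 0 ->
  r ^+ n * ev2 e (homothety A (1 - d / r) X) = ev2 p X + r * ev2 q X.
(* Multiplication by [r] turns p + rq into Nq + rp; this brings two summands to a common
   exponent. *)
have raise k n (e p q : {mpoly K[2]}) : num n e p q ->
    exists p' q' : {mpoly K[2]}, num (k + n)%N e p' q'.
  move=> enum; elim: k => [|k [p' [q' IHk]]]; first by exists p, q.
  exists (N * q'), p' => X r rX r0.
  by rewrite addSn exprS -mulrA IHk // ev2M ev2N -rX; ring.
elim/mpoly_ring_ind: f => [c|i|e f [n [p [q enum]]] [n' [p' [q' fnum]]]|e f
    [n [p [q enum]]] [n' [p' [q' fnum]]]].
- exists 0%N, c%:MP, 0%:MP => X r _ _.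
  by rewrite expr0 mul1r !ev2C mulr0 addr0.
- pose c := if val i == 0%N then A.1 else A.2.
  exists 1%N, (- d%:MP * ('X_i - c%:MP)), 'X_i => X r _ r0.
  rewrite /ev2 mevalM mevalN mevalB !mevalC !mevalXU /c /=.
  by case: (val i == 0%N); field.
- have [p1 [q1 e1]] := raise n' _ _ _ _ enum.
  have [p2 [q2 f2]] := raise n _ _ _ _ fnum.
  exists (n' + n)%N, (p1 + p2), (q1 + q2) => X r rX r0.
  by rewrite !ev2D mulrDr e1 // addnC f2 //; ring.
- exists (n + n')%N, (p * p' + N * (q * q')), (p * q' + q * p') => X r rX r0.
  rewrite !(ev2D, ev2M) ev2N -rX exprD mulrACA enum // fnum //; ring.
Qed.

(* The product of the numerators for the two square roots [r] and [- r] is a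
   polynomial in [X]. *)
Lemma conchoid_equation (f : {mpoly K[2]}) (A : pt K) (d : K) :
  finite_on_lines_through (curve f) A ->
  exists2 G : {poly {poly K}}, G != 0 &
    forall X, pi1B f A.1 A.2 d X -> eval_xy G X = 0.
Proof.
move=> Cfin; have [n [p [q pqE]]] := homothety_numerator f A d.
have [N ev2N] := ex_sqdist_mpoly A.
(* The norm p² - Nq² of p + rq, times [N] so that [G] also vanishes where r = 0 and the two
   candidates are undefined. *)
have [G def_G] := of_xy_surj (N * (p * p + - 1%:MP * (N * (q * q)))).
have GE X r : r ^+ 2 = sqdist A X ->
    eval_xy G X = r ^+ 2 * ((ev2 p X + r * ev2 q X) * (ev2 p X + - r * ev2 q X)).
  move=> rX; rewrite -ev2_of_xy -def_G !(ev2D, ev2M) ev2N -rX.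
  by rewrite -mpolyCN ev2C; ring.
exists G; last first.
  move=> X [P [w BXP]]; have CP : curve f P by case: BXP.
  have [r rX] := ex_sqrt (sqdist A X); rewrite (GE X r rX).
  have [->|r0] := eqVneq r 0; first by rewrite expr0n mul0r.
  have [def_P|def_P] := Bset_fiber BXP rX r0.
    by rewrite -pqE // -def_P CP mulr0 mul0r mulr0.
  rewrite -(pqE X (- r)) ?sqrrN ?oppr_eq0 // invrN mulrN opprK.
  by rewrite -def_P CP !mulr0.
(* [G] is nonzero at a point of the horizontal line through [A]: [t] lists the abscissas [r],
   relative to [A], that are zero or have a candidate r - d or r + d on the curve. *)
have [s sP] := Cfin 0 1 (or_intror (oner_neq0 _)).
pose t := 0 :: [seq P.1 - A.1 + d | P <- s] ++ [seq P.1 - A.1 - d | P <- s].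
have [r rt] : exists r, r \notin t.
  apply: NNPP => nr; apply: infinite_field; exists t => r _.
  by apply/negPn/negP => rt; apply: nr; exists r.
move: rt; rewrite inE mem_cat !negb_or => /and3P[r0 rs1 rs2].
pose X : pt K := (A.1 + r, A.2).
have rX : r ^+ 2 = sqdist A X by rewrite /sqdist /=; ring.
have nC c : A.1 + c \notin map fst s -> ev2 f (A.1 + c, A.2) != 0.
  apply: contra => /eqP fP; apply: (map_f fst (x := (A.1 + c, A.2))); apply: sP.
  by split; [exact: fP|rewrite /=; ring].
apply/eqP => G0; have := GE X r rX.
rewrite G0 /eval_xy !horner0 -(pqE X r) // -(pqE X (- r)) ?sqrrN ?oppr_eq0 //.
have -> : homothety A (1 - d / r) X = (A.1 + (r - d), A.2).
  by rewrite /homothety /=; congr pair; field.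
have -> : homothety A (1 - d / - r) X = (A.1 + (r + d), A.2).
  by rewrite /homothety /= invrN mulrN opprK; congr pair; field.
move/eqP; rewrite eq_sym !mulf_eq0 !expf_eq0 oppr_eq0 (negPf r0) !andbF /=.
apply/negP; rewrite negb_or !nC //.
  apply: contra rs2 => /mapP[P Ps E]; apply/mapP; exists P => //.
  by rewrite -E /=; ring.
apply: contra rs1 => /mapP[P Ps E]; apply/mapP; exists P => //.
by rewrite -E /=; ring.
Qed.

End Bivariate.

(** * Existence of a simple component *)

Theorem theorem3 (K : closedFieldType) (f : {mpoly K[2]}) (a b d : K) :
  [pchar K] =i pred0 ->
  irreducible_mpoly f ->
  d != 0 ->
  (exists p, C0 f a b p) ->
  ~ is_circle_centered (curve f) a b ->
  ~ is_line_through (curve f) a b ->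
  exists M : pset K, irreducible_component M (conchoid f a b d) /\
                     simple_component f a b d M.
Proof.
move=> char0 firr d0 _ _ noline; pose A : pt K := (a, b).
have Cfin : finite_on_lines_through (curve f) A by apply: finite_on_lines.
have [fnconst _] := firr.
have Sinf := unique_preimage_infinite char0 d0 (curve_infinite fnconst) Cfin.
have [G G0 GE] := conchoid_equation d Cfin.
have [|M [Mcomp [Omega [On0 OS OM Ocl]]]] := ex_component_dense _ Sinf G0 GE.
  by move=> X [y [[w BXy] _]]; exists y, w.
by exists M; split=> //; exists Omega.
Qed.
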